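(* Let $K\in\mathbb{N}\cup\{\infty\}$ and let $$Y_0^{(K)}:=\sup\left\{\mathbb{E}[Z_{\mathfrak{t}}] : \mathfrak{t}\text{ an } \mathbb{F}\text{-stopping time with } \mathfrak{t}(\omega)\in\mathcal{T}_K(\omega)\text{ a.s.}\right\}.$$ Then $$Y_0^{(K)}=\sup_{\mathfrak{n}\in\mathcal{N},\ \mathfrak{n}\le K}\mathbb{E}[U_{\mathfrak{n}}].$$
   Context: $\mathbb{N}=\{1,2,\dots\}$, $\mathbb{N}_0=\mathbb{N}\cup\{0\}$. $(\Omega,\mathcal{F},\mathbb{F},\mathbb{P})$ is a filtered probability space with $\mathbb{F}=(\mathcal{F}_t)_{0\le t\le\infty}$ satisfying the usual conditions. $(\tau_i)_{i\in\mathbb{N}_0}$ is a sequence of $\mathbb{F}$-stopping times with, a.s., $\tau_0=0$, $\tau_i<\tau_{i+1}<\infty$ for all $i\in\mathbb{N}_0$, and $\lim_{i\to\infty}\tau_i=\infty$. For $K\in\mathbb{N}\cup\{\infty\}$, $\mathcal{T}_K(\omega):=\{\tau_i(\omega): i\in\mathbb{N}_0,\ i\le K\}$. $T\in(0,\infty)$ is a fixed horizon. $Z=(Z_t)_{0\le t<\infty}$ is a non-negative $\mathbb{F}$-adapted process, càdlàg on $[0,T]$, such that almost surely $Z_t=0$ for all $t>T$. Standing integrability assumption: $\mathbb{E}[\sup_{i\in\mathbb{N}_0}Z_{\tau_i}^{\alpha}]\le B^{\alpha}$ for some $B>0$ and $\alpha>1$. $U_i:=Z_{\tau_i}$, $\mathcal{G}_i:=\mathcal{F}_{\tau_i}=\{A\in\mathcal{F}_\infty: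 A\cap\{\tau_i\le t\}\in\mathcal{F}_t \text{ for all } t\ge0\}$, $\mathbb{G}:=(\mathcal{G}_i)_{i\in\mathbb{N}_0}$, and $\mathcal{N}$ is the set of all maps $\mathfrak{n}:\Omega\to\mathbb{N}_0$ with $\{\mathfrak{n}=i\}\in\mathcal{G}_i$ for all $i\in\mathbb{N}_0$. *)

(* Defs.v *)
From HB Require Import structures.
From mathcomp Require Import all_boot all_order all_algebra.
From mathcomp Require Import all_classical all_reals all_analysis.
Import Order.TTheory GRing.Theory Num.Theory.
Import numFieldNormedType.Exports.

Set Implicit Arguments.
Unset Strict Implicit.
Unset Printing Implicit Defensive.

Local Open Scope classical_set_scope.
Local Open Scope ring_scope.
Local Open Scope ereal_scope.

(* Time is [0, +oo], a part of \bar R: a filtration is a family of sigma-algebras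
   indexed by \bar R of which only the members F t with 0 <= t matter.
   F +oo is any sigma-algebra containing all the F t; it is not required to be
   generated by them. *)

Definition is_filtration (d : measure_display) (Omega : measurableType d)
    (R : realType) (F : \bar R -> set (set Omega)) : Prop :=
  [/\ forall t, 0 <= t -> sigma_algebra [set: Omega] (F t),
      forall t, 0 <= t -> F t `<=` measurable
    & forall s t, 0 <= s -> s <= t -> F s `<=` F t].

(* As F 0 consists of measurable sets, the first clause entails that P is
   complete. *)
Definition usual_conditions (d : measure_display) (Omega : measurableType d)
    (R : realType) (P : probability Omega R)
    (F : \bar R -> set (set Omega)) : Prop :=
  P.-negligible `<=` F 0 /\
  forall t : R, (0 <= t)%R ->
    F t%:E = \bigcap_(s in [set s : R | (t < s)%R]) F s%:E.

Definition stopping_time (Omega : Type) (R : realType)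
    (F : \bar R -> set (set Omega)) (tau : Omega -> \bar R) : Prop :=
  (forall w, 0 <= tau w) /\
  forall t : R, (0 <= t)%R -> F t%:E [set w | tau w <= t%:E].

Definition stopped_sigma_algebra (Omega : Type) (R : realType)
    (F : \bar R -> set (set Omega)) (tau : Omega -> \bar R) :
    set (set Omega) :=
  [set A | F +oo A /\
    forall t : R, (0 <= t)%R -> F t%:E (A `&` [set w | tau w <= t%:E])].

(* A process is given by its values Z t at real times t; only 0 <= t matters. *)
Definition adapted (d : measure_display) (Omega : measurableType d)
    (R : realType) (F : \bar R -> set (set Omega)) (Z : R -> Omega -> R) :
    Prop :=
  forall t : R, (0 <= t)%R ->
    measurable_fun [set: g_sigma_algebraType (F t%:E)] (Z t).

Definition cadlag_on (R : realType) (T : R) (f : R -> R) : Prop :=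
  (forall t : R, (0 <= t < T)%R -> f s @[s --> t^'+] --> f t) /\
  (forall t : R, (0 < t <= T)%R -> cvg (f s @[s --> t^'-])).

(* Z_tau, with Z_{+oo} = 0; the times at which it is used are almost surely
   finite, so this convention affects null sets only. *)
Definition stopped_value (Omega : Type) (R : realType) (Z : R -> Omega -> R)
    (tau : Omega -> \bar R) (w : Omega) : R :=
  if tau w is t%:E then Z t w else 0%R.

(* K : option nat stands for an element of {0, 1, 2, ...} U {oo}, oo being
   None. *)
Definition le_extnat (i : nat) (K : option nat) : bool :=
  if K is Some k then (i <= k)%N else true.

Definition exercise_times (Omega : Type) (R : realType)
    (tau : nat -> Omega -> \bar R) (K : option nat) (w : Omega) : set (\bar R) :=
  [set tau i w | i in [set i | le_extnat i K]].

Definition optimal_value (d : measure_display) (Omega : measurableType d)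
    (R : realType) (P : probability Omega R) (F : \bar R -> set (set Omega))
    (tau : nat -> Omega -> \bar R) (Z : R -> Omega -> R) (K : option nat) :
    \bar R :=
  ereal_sup ((fun t => 'E_P[stopped_value Z t]) @`
    [set t | stopping_time F t /\
             {ae P, forall w, exercise_times tau K w (t w)}]).

Definition discrete_stopping_time (Omega : Type) (G : nat -> set (set Omega))
    (n : Omega -> nat) : Prop :=
  forall i, G i [set w | n w = i].

Definition discrete_optimal_value (d : measure_display)
    (Omega : measurableType d) (R : realType) (P : probability Omega R)
    (G : nat -> set (set Omega)) (U : nat -> Omega -> R) (K : option nat) :
    \bar R :=
  ereal_sup ((fun n => 'E_P[fun w => U (n w) w]) @`
    [set n | discrete_stopping_time G n /\ forall w, le_extnat (n w) K]).

(* Main.v *)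
Require Import Defs.
From HB Require Import structures.
From mathcomp Require Import all_boot all_order all_algebra.
From mathcomp Require Import all_classical all_reals all_analysis.
From mathcomp Require Import measurable_realfun.
Import Order.TTheory GRing.Theory Num.Theory.
Import numFieldNormedType.Exports.

Local Open Scope classical_set_scope.
Local Open Scope ring_scope.
Local Open Scope ereal_scope.

(* A discrete stopping time n yields the stopping time t = tau_n. Conversely,
   given t, let n be an index i <= K with tau_i = t when there is one. Almost
   surely the tau_i are pairwise distinct, so {n = i} coincides, up to a null
   set, with {t = tau_i}, which belongs to F_{tau_i}; the null set is harmless
   because F_0 contains all null sets. The payoffs Z_t and Z_{tau_n} then agree
   almost surely, and integrals of non-negative functions defined as suprema
   over simple functions only depend on almost sure values, even without
   measurability of the payoffs. *)

Section ae_integral.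
Import HBNNSimple.

(** A simple function below [f], set to zero on the exceptional null set [N], keeps its integral and
    lies below [g] everywhere; so each term of one supremum is dominated by the other. *)
Lemma ge0_ae_le_integralT {d} {T : measurableType d} {R : realType}
    (mu : {measure set T -> \bar R}) (f g : T -> \bar R) :
  (forall x, 0 <= f x) -> (forall x, 0 <= g x) ->
  {ae mu, forall x, f x <= g x} -> \int[mu]_x f x <= \int[mu]_x g x.
Proof.
move=> f0 g0 [N [mN N0 fgN]].
rewrite (ge0_integralTE _ f0) (ge0_integralTE _ g0).
apply: ge_ereal_sup => _ [h /= hf <-].
have [h' h'E] : exists h' : {nnsfun T >-> R}, forall x, h' x = (h \_ (~` N)) x.
  by exists (proj_nnsfun h (measurableC mN)) => x; rewrite (mrestrict h (measurableC mN)).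
have -> : sintegral mu h = sintegral mu h'.
  rewrite -!integralT_nnsfun.
  apply: ae_eq_integral => //; [exact/measurable_EFinP..|].
  exists N; split => // x /= /not_implyP[_ hx]; apply: contrapT => Nx.
  by apply: hx; rewrite h'E patchE mem_set.
apply: ereal_sup_ubound; exists h' => // x; rewrite h'E patchE.
case: ifPn => [/set_mem Nx|_]; last exact: g0.
apply: (le_trans (hf x)); apply: contrapT => gx.
by apply: Nx; apply: fgN.
Qed.

End ae_integral.

Section filtration.
Context {d : measure_display} {Omega : measurableType d} {R : realType}.
Variable F : \bar R -> set (set Omega).
Hypothesis F_filtration : is_filtration F.

Let measurableF u : 0 <= u -> (F u).-sigma.-measurable = F u.
Proof.
case: F_filtration => + _ _ u0 => /(_ u u0).
exact: measurable_g_measurableTypeE.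
Qed.

(** For real [r < u] the event that the capped time is at most [r] is that of [tau] itself, hence
    lies in [F r] (it is empty if [r < 0]); for [r >= u] it is the whole space. *)
Lemma measurable_stopping_time_min (tau : Omega -> \bar R) (u : \bar R) :
  stopping_time F tau -> 0 <= u ->
  measurable_fun [set: g_sigma_algebraType (F u)] (fun w => mine (tau w) u).
Proof.
move=> [tau0 tauF] u0; case: (F_filtration) => _ _ F_mono.
apply: (measurability _ (ErealGenOInfty.measurableE R)) => _ [_ [r ->] <-].
rewrite setTI (_ : _ @^-1` _ =
    ~` [set w : g_sigma_algebraType (F u) | mine (tau w) u <= r%:E]); last first.
  by apply/seteqP; split => w /=; rewrite in_itv/= andbT ltNge => /negP.
apply: measurableC; rewrite (measurableF _ u0).
have [ur|ru] := leP u r%:E.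
  rewrite (_ : [set _ | _] = setT); first by rewrite -(measurableF _ u0).
  by apply/seteqP; split => // w _ /=; rewrite ge_min ur orbT.
have [r0|r0] := leP 0%R r.
  apply: (F_mono r%:E); rewrite ?lee_fin//; first exact: ltW.
  rewrite (_ : [set _ | _] = [set w | tau w <= r%:E]); first exact: tauF.
  by apply/seteqP; split => w /=; rewrite ge_min (leNgt u) ru orbF.
rewrite (_ : [set _ | _] = set0); first by rewrite -(measurableF _ u0).
apply/seteqP; split => // w /=; rewrite leNgt => /negP; apply.
by rewrite lt_min (lt_le_trans _ (tau0 w)) ?(lt_le_trans _ u0) ?lte_fin.
Qed.

(** Where both times are at most [u], capping at [u] changes neither, so their equality is that of
    two [F u]-measurable functions. *)
Lemma stopping_time_eq_le (s t : Omega -> \bar R) (u : \bar R) :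
  stopping_time F s -> stopping_time F t -> 0 <= u ->
  F u ([set w | s w = t w] `&` [set w | t w <= u]).
Proof.
move=> sF tF u0; rewrite -(measurableF _ u0).
have ms := measurable_stopping_time_min _ _ sF u0.
have mt := measurable_stopping_time_min _ _ tF u0.
have meas_le (r : Omega -> \bar R) : stopping_time F r ->
    (F u).-sigma.-measurable [set w | r w <= u].
  (* Stopping times are defined through real times only; at [u = +oo] the event is the whole
     space. *)
  move=> [_ rF]; rewrite (measurableF _ u0); case: u u0 {ms mt} => [u u0|_|//].
  - exact: rF.
  - rewrite (_ : [set _ | _] = setT); first by rewrite -measurableF.
    by apply/seteqP; split => // w _ /=; rewrite leey.
have := measurable_eqe (@measurableT _ (g_sigma_algebraType (F u))) ms mt.
rewrite setTI => /measurableI /(_ (meas_le _ sF)).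
move=> /measurableI /(_ (meas_le _ tF)).
congr (_.-measurable _); apply/seteqP; split => w /=.
  by move=> [[+ su] tu]; rewrite (min_l su) (min_l tu).
by move=> [-> tu].
Qed.

(** Letting [u] range up to [+oo] merges the two clauses of the definition, since at [+oo] the
    intersection is [A] itself. *)
Lemma stopped_sigma_algebraP (tau : Omega -> \bar R) (A : set Omega) :
  (forall u, 0 <= u -> F u (A `&` [set w | tau w <= u])) ->
  stopped_sigma_algebra F tau A.
Proof.
move=> AF; split=> [|t t0]; last by apply: AF; rewrite lee_fin.
have := AF +oo le0y; congr (F _ _).
by apply/seteqP; split => [w []|w Aw] //; split => //=; rewrite leey.
Qed.

Lemma stopping_time_discrete (tau : nat -> Omega -> \bar R) (n : Omega -> nat) :
  (forall i, stopping_time F (tau i)) ->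
  discrete_stopping_time (fun i => stopped_sigma_algebra F (tau i)) n ->
  stopping_time F (fun w => tau (n w) w).
Proof.
move=> tauF nF; split => [w|t t0]; first exact: (tauF _).1.
rewrite (_ : [set _ | _] = \bigcup_i ([set w | n w = i] `&`
    [set w | tau i w <= t%:E])); last first.
  by apply/seteqP; split => [w tw|w [i _ [/= ->]]//]; exists (n w).
case: F_filtration => /(_ t%:E)[]; rewrite ?lee_fin// => _ _ + _ _; apply.
by move=> i; exact: (nF i).2.
Qed.

(** [B] is obtained from [A] by changes inside a negligible set, every subset of which is negligible
    and so already in [F 0]. *)
Lemma ae_eq_filtration (P : probability Omega R) (u : \bar R) (A B : set Omega) :
  P.-negligible `<=` F 0 -> 0 <= u -> F u A ->
  {ae P, forall w, A w <-> B w} -> F u B.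
Proof.
move=> PF u0 FA AB; set N := ~` [set w | A w <-> B w] in AB.
case: (F_filtration) => _ _ /(_ 0 u (lexx _) u0) F0u.
have FN C : C `<=` N -> (F u).-sigma.-measurable C.
  move=> CN; rewrite measurableF//; apply/F0u/PF.
  exact: negligibleS CN AB.
rewrite -measurableF// in FA *.
rewrite (_ : B = (A `\` N) `|` (B `&` N)).
  by apply: measurableU; [apply: measurableD => //|]; exact: FN.
apply/seteqP; split => w.
- have [Nw Bw|/contrapT ABw Bw] := pselect (N w); first by right.
  by left; split => [|/(_ ABw)//]; exact/ABw.
- by move=> [[Aw /contrapT ABw]|[]//]; exact/ABw.
Qed.

End filtration.

Theorem proposition1
  (R : realType) (d : measure_display) (Omega : measurableType d)
  (P : probability Omega R)
  (F : \bar R -> set (set Omega))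
  (F_filtration : is_filtration F)
  (F_usual : usual_conditions P F)
  (tau : nat -> Omega -> \bar R)
  (tau_stopping : forall i, stopping_time F (tau i))
  (tau_grid : {ae P, forall w, [/\ tau 0%N w = 0,
      forall i, tau i w < tau i.+1 w < +oo &
      (fun i => tau i w) @ \oo --> +oo]})
  (T : R) (T_gt0 : (0 < T)%R)
  (Z : R -> Omega -> R)
  (Z_ge0 : forall (t : R) w, (0 <= t)%R -> (0 <= Z t w)%R)
  (Z_adapted : adapted F Z)
  (Z_cadlag : forall w, cadlag_on T (fun t => Z t w))
  (Z_after : {ae P, forall w, forall t : R, (T < t)%R -> Z t w = 0%R})
  (B alpha : R) (B_gt0 : (0 < B)%R) (alpha_gt1 : (1 < alpha)%R)
  (Z_integrable :
    \int[P]_w ereal_sup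
      (range (fun i => (stopped_value Z (tau i) w `^ alpha)%R%:E))
    <= (B `^ alpha)%R%:E)
  (K : option nat) (K_ge1 : K <> Some 0%N) :
  optimal_value P F tau Z K =
  discrete_optimal_value P
    (fun i => stopped_sigma_algebra F (tau i))
    (fun i => stopped_value Z (tau i)) K.
Proof.
have value_ge0 (t : Omega -> \bar R) w : 0 <= t w -> (0 <= stopped_value Z t w)%R.
  by rewrite /stopped_value; case: (t w) => // r; rewrite lee_fin; exact: Z_ge0.
apply/eqP; rewrite eq_le; apply/andP; split; last first.
  apply: ge_ereal_sup => _ [n [nF nK] <-].
  apply: ereal_sup_ubound; exists (fun w => tau (n w) w) => //.
  split; first exact: stopping_time_discrete.
  by apply: aeW => w; exists (n w) => //; exact: nK.
apply: ge_ereal_sup => _ [t [tF t_tau] <-].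
pose S w := [set i | le_extnat i K /\ tau i w = t w].
(* The default index 0 satisfies every bound [K], so [n] respects [K] at every point, also where
   [S w] is empty. *)
pose n w := xget 0%N (S w).
have n_prop : {ae P, forall w, S w (n w) /\ forall i, S w i <-> n w = i}.
  apply: filterS2 tau_grid t_tau => w [_ tau_lt _] [j jK tj].
  have Sn : S w (n w) by apply: (@xgetPex _ 0%N (S w)); exists j.
  split => // i; split => [[_ ti]|<-//].
  (* Strict increase of the grid makes the index of a grid time unique, so [S w] is a singleton. *)
  have tau_inj : injective (tau ^~ w).
    apply/inc_inj/le_mono; apply: homo_ltn => [x y z|]; first exact: lt_trans.
    by move=> k; case/andP: (tau_lt k).
  by apply: tau_inj; rewrite Sn.2 ti.
apply: (@le_trans _ _ 'E_P[fun w => stopped_value Z (tau (n w)) w]).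
  rewrite unlock; apply: ge0_ae_le_integralT => [w|w|].
  - by rewrite lee_fin; apply: value_ge0; exact: tF.1.
  - by rewrite lee_fin; apply: value_ge0; exact: (tau_stopping _).1.
  - by apply: filterS n_prop => w [[_ tn] _]; rewrite /stopped_value tn.
apply: ereal_sup_ubound; exists n => //; split => [i|w]; last first.
  by rewrite /n; case: xgetP => [j _ []|_]//; case: (K).
apply: stopped_sigma_algebraP => // u u0.
have FN := F_usual.1.
have F_ae A B' := ae_eq_filtration _ F_filtration P u A B' FN u0.
have [iK|iK] := boolP (le_extnat i K).
  apply: (F_ae ([set w | t w = tau i w] `&` [set w | tau i w <= u])).
    exact: stopping_time_eq_le.
  apply: filterS n_prop => w [_ /(_ i)[Sn nS]]; split => -[/= + tu].
    by move=> ti; split => //; apply: Sn.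
  by move=> /nS[_ ti]; split.
(* An index beyond [K] is almost surely never selected, so the event is compared with the empty
   set. *)
apply: (F_ae set0); first by case: (F_filtration) => /(_ u u0)[].
apply: filterS n_prop => w [_ /(_ i)[_ nS]]; split => // -[/nS[]].
by rewrite (negbTE iK).
Qed.
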